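(* Let $G$ be a finite group. Every gluing problem for super class functions at $G$ has infinitely many solutions: for every gluing data $(f_H)_{1<H\le G}\in\varprojlim_{1<H\le G}B^*(N_G(H)/H)$ there are infinitely many $f\in B^*(G)$ such that $\mathrm{Des}^G_{N_G(H)/H}f=f_H$ for every nontrivial subgroup $H$ of $G$.
   Context: $B^*(G)=\mathrm{Hom}_{\mathbb{Z}}(B(G),\mathbb{Z})$ is the $\mathbb{Z}$-dual of the Burnside ring of $G$, identified with the group of super class functions: functions $f$ from the set of subgroups of $G$ to $\mathbb{Z}$ that are constant on conjugacy classes of subgroups, with $f(H)=f(G/H)$. The destriction map (restriction followed by deflation) $\mathrm{Des}^G_{N_G(H)/H}:B^*(G)\to B^*(N_G(H)/H)$ is given by $(\mathrm{Des}^G_{N_G(H)/H}f)(L/H)=f(L)$ for $H\le L\le N_G(H)$. $\varprojlim_{1<H\le G}B^*(N_G(H)/H)$ is the group of gluing data: sequences $(f_H)_{1<H\le G}$ indexed by the nontrivial subgroups of $G$, with $f_H\in B^*(N_G(H)/H)$, such that: (i) ${}^gf_H=f_{{}^gH}$ for all $g\in G$ and $1\neq H\le G$, where ${}^g(-)$ is transport of structure by conjugation by $g$; (ii) for all nontrivial subgroups $H\trianglelefteq K$ of $G$, with $N_G(H,K)=N_G(H)\cap N_G(K)$, $\mathrm{Des}^{N_G(H)/H}_{N_G(H,K)/K}f_H=\mathrm{Res}^{N_G(K)/K}_{N_G(H,K)/K}f_K$; explicitly $f_H(L/H)=f_K(L/K)$ for all $K\le L\le N_G(H,K)$. *)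

(* Defs.v *)
From mathcomp Require Import all_boot all_algebra all_fingroup.

Set Implicit Arguments.
Unset Strict Implicit.
Unset Printing Implicit Defensive.

Local Open Scope group_scope.

(* As for class functions 'CF(G) in the library, a super class function on G  *)
(* is represented by its extension by 0 to all subgroups of the ambient type, *)
(* so that equality of representatives is equality on the subgroups of G.     *)
Definition super_class_fun (gT : finGroupType) (G : {set gT}) :
    {pred {ffun {group gT} -> int}} :=
  [pred f : {ffun {group gT} -> int} |
    [forall L : {group gT}, (~~ (L \subset G)) ==> (f L == 0%R)]
 && [forall L : {group gT}, forall x in G,
       (L \subset G) ==> (f (L :^ x)%G == f L)]].

Definition scf_res (gT : finGroupType) (M : {set gT})
    (f : {ffun {group gT} -> int}) : {ffun {group gT} -> int} :=
  [ffun L : {group gT} => if L \subset M then f L else 0%R].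

Section Destriction.

Variables (gT : finGroupType) (G : {group gT}).
Implicit Types (H K L M : {group gT}) (x : gT).

(* Des^G_(N_G(H)/H). A subgroup of a quotient by H is L / H where L is its    *)
(* preimage under coset H; see scf_desE.                                      *)
Definition scf_des H (f : {ffun {group gT} -> int}) :
    {ffun {group coset_of H} -> int} :=
  [ffun Q : {group coset_of H} =>
     if Q \subset 'N_G(H) / H then f (coset H @*^-1 Q)%G else 0%R].

(* Des^(N_G(H)/H)_(M/K) for H <= K <| M <= N_G(H): since M / K is identified  *)
(* with (M / H) / (K / H), it sends f to L / K |-> f (L / H); see scf_desqE.  *)
Definition scf_desq H M K (f : {ffun {group coset_of H} -> int}) :
    {ffun {group coset_of K} -> int} :=
  [ffun Q : {group coset_of K} =>
     if Q \subset M / K then f ((coset K @*^-1 Q) / H)%G else 0%R].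

(* Transport of structure along N_G(H)/H -> N_G(H :^ x)/(H :^ x), for x in G; *)
(* see scf_conjE. As H :^ x is the conjugate of H by x^-1 on the left, this   *)
(* is the left action of x^-1.                                                *)
Definition scf_conj H x (f : {ffun {group coset_of H} -> int}) :
    {ffun {group coset_of (H :^ x)%G} -> int} :=
  [ffun Q : {group coset_of (H :^ x)%G} =>
     if Q \subset 'N_G(H :^ x) / (H :^ x)
     then f (((coset (H :^ x) @*^-1 Q) :^ x^-1) / H)%G else 0%R].

Record gluing_data (f : forall H, {ffun {group coset_of H} -> int}) : Prop :=
  GluingData {
    gluing_scf : forall H, H :!=: 1 -> H \subset G ->
      f H \in super_class_fun ('N_G(H) / H);
    gluing_conj : forall x H, x \in G -> H :!=: 1 -> H \subset G ->
      scf_conj x (f H) = f (H :^ x)%G;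
    gluing_des : forall H K, H :!=: 1 -> K :!=: 1 -> H <| K -> K \subset G ->
      scf_desq ('N_G(H) :&: 'N_G(K))%G K (f H)
      = scf_res (('N_G(H) :&: 'N_G(K)) / K) (f K)
  }.

Lemma scf_desE H L f :
  H \subset L -> L \subset 'N_G(H) -> scf_des H f (L / H)%G = f L.
Proof.
move=> sHL sLN; rewrite ffunE quotientS //; congr (f _).
by apply/val_inj/quotientGK; rewrite /normal sHL (subset_trans sLN) ?subsetIr.
Qed.

Lemma scf_desqE H K L M f :
    K \subset L -> L \subset M -> M \subset 'N(K) ->
  scf_desq M K f (L / K)%G = f (L / H)%G.
Proof.
move=> sKL sLM nKM; rewrite ffunE quotientS //; congr (f _).
apply: val_inj; congr (_ / H); apply: quotientGK.
by rewrite /normal sKL (subset_trans sLM).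
Qed.

Lemma scf_conjE H L x f :
    x \in G -> H \subset L -> L \subset 'N_G(H) ->
  scf_conj x f (L :^ x / (H :^ x))%G = f (L / H)%G.
Proof.
move=> Gx sHL sLN.
have sLNx : L :^ x \subset 'N_G(H :^ x) by rewrite normJ -{1}(conjGid Gx) -conjIg conjSg.
rewrite ffunE quotientS //; congr (f _).
apply: val_inj; congr (_ / H) => /=.
rewrite (@quotientGK _ (H :^ x) (L :^ x)) ?conjsgK //.
by rewrite /normal conjSg sHL (subset_trans sLNx) ?subsetIr.
Qed.

End Destriction.

(* Main.v *)
Require Import Defs.
From mathcomp Require Import all_boot all_algebra all_fingroup.
From mathcomp Require Import classical_sets cardinality.

(** A solution [h] is forced away from the trivial subgroup: the equation
    [scf_des G L h = f L], read at the trivial subgroup [L / L], says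
    [h L = f L (L / L)].  Conversely these values solve the gluing problem.
    If [H] is nontrivial and [H <| L], compatibility for the pair [(H, L)], read
    at [L] itself, is exactly [f H (L / H) = f L (L / L)]
    ([gluing_data_self]), and conjugation invariance of the family makes
    [L |-> f L (L / L)] constant on conjugacy classes ([gluing_data_selfJ]).
    The trivial subgroup contains no nontrivial [H], so no equation mentions
    [h 1]; it is moreover alone in its conjugacy class.  Hence every integer is
    an admissible value of [h 1], and distinct integers give distinct
    solutions. *)

Set Implicit Arguments.
Unset Strict Implicit.
Unset Printing Implicit Defensive.

Local Open Scope group_scope.

Section Gluing.

Variables (gT : finGroupType) (G : {group gT}).
Variable f : forall H : {group gT}, {ffun {group coset_of H} -> int}.
Implicit Types (H L : {group gT}) (c : int).

Definition glue c : {ffun {group gT} -> int} :=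
  [ffun L : {group gT} =>
     if L \subset G then if L :==: 1 then c else f L (L / L)%G else 0%R].

Hypothesis gluing_f : gluing_data G f.

(** This is the compatibility condition for [H <| L] at the smallest subgroup
    on which it says something, namely [L] itself. *)
Lemma gluing_data_self H L :
    H :!=: 1 -> H \subset L -> L \subset 'N_G(H) ->
  f H (L / H)%G = f L (L / L)%G.
Proof.
move=> ntH sHL; rewrite finset.subsetI => /andP[sLG nHL].
have ntL : L :!=: 1 by apply: contraNneq ntH => L1; rewrite -subG1 -L1.
have sLNN : L \subset ('N_G(H) :&: 'N_G(L))%G.
  by rewrite !finset.subsetI sLG nHL normG.
have nLH : H <| L by apply/andP.
have := gluing_des gluing_f ntH ntL nLH sLG.
move=> /(congr1 (fun u : {ffun {group coset_of L} -> int} => u (L / L)%G)).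
rewrite scf_desqE // ?ffunE ?quotientS //.
by rewrite (fintype.subset_trans (finset.subsetIr _ _)) // finset.subsetIr.
Qed.

Lemma gluing_data_selfJ L x :
    L :!=: 1 -> L \subset G -> x \in G ->
  f (L :^ x)%G (L :^ x / (L :^ x))%G = f L (L / L)%G.
Proof.
move=> ntL sLG Gx; rewrite -(gluing_conj gluing_f Gx ntL sLG).
by rewrite scf_conjE // finset.subsetI sLG normG.
Qed.

Lemma glue_super_class_fun c : glue c \in super_class_fun G.
Proof.
rewrite inE; apply/andP; split; apply/forallP => L.
  by apply/implyP => /negPf nsLG; rewrite ffunE nsLG.
apply/forall_inP => x Gx; apply/implyP => sLG; rewrite !ffunE /=.
rewrite -{1}(conjGid Gx) conjSg sLG conjsg_eq1.
by have [// | ntL] := ifPn; rewrite gluing_data_selfJ.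
Qed.

Lemma scf_des_glue c H : H :!=: 1 -> H \subset G -> scf_des G H (glue c) = f H.
Proof.
move=> ntH sHG; apply/ffunP => Q; rewrite ffunE.
case: ifPn => [sQN | nsQN]; last first.
  have /andP[/forallP/(_ Q) + _] := gluing_scf gluing_f ntH sHG.
  by rewrite nsQN => /eqP.
set L := (coset H @*^-1 Q)%G.
have sHL : H \subset L by apply: sub_cosetpre.
have sLN : L \subset 'N_G(H).
  have nHN : H <| 'N_G(H) by rewrite normal_subnorm.
  by rewrite -(quotientGK nHN) morphpreS.
have ntL : L :!=: 1 by apply: contraNneq ntH => L1; rewrite -subG1 -L1.
have QE : Q = (L / H)%G by apply: val_inj; rewrite /= cosetpreK.
rewrite ffunE (fintype.subset_trans sLN) ?finset.subsetIl // (negPf ntL).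
by rewrite -(gluing_data_self ntH) // -QE.
Qed.

Lemma glue_inj : injective glue.
Proof.
by move=> c d /ffunP/(_ 1%G); rewrite !ffunE sub1G eqxx.
Qed.

End Gluing.

Theorem corollary3p2 (gT : finGroupType) (G : {group gT})
    (f : forall H : {group gT}, {ffun {group coset_of H} -> int})
    (gluing_f : gluing_data G f) :
  infinite_set
    [set h : {ffun {group gT} -> int} |
       h \in super_class_fun G /\
       forall H : {group gT}, H :!=: 1 -> H \subset G ->
         scf_des G H h = f H]%classic.
Proof.
pose glue_nat (n : nat) := glue G f (Posz n).
have glue_nat_inj : injective glue_nat by move=> m n /glue_inj[].
move=> fin_sol; apply: infinite_nat.
apply: sub_finite_set (finite_preimage (in2W glue_nat_inj) fin_sol) => n _.
by split=> [|H]; [apply: glue_super_class_fun | apply: scf_des_glue].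
Qed.
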